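(* Let $G$ be a graph without isolated vertices and without false twins. Then $\gamma_{OLD}(M(G))\le\gamma_{OLD}(G)+2$.
   Context: All graphs are finite, simple and connected. For a graph $G=(V,E)$ and $x\in V$, $N(x)$ is the open neighbourhood. Two distinct vertices $x,y$ are false twins if $N(x)=N(y)$. A set $C\subseteq V$ is an open locating-dominating set ($OLD$-set) if $N(x)\cap C\neq\emptyset$ for all $x\in V$ and $N(x)\cap C\ne N(y)\cap C$ for all distinct $x,y\in V$; $\gamma_{OLD}(G)$ is the minimum size of an $OLD$-set. The Mycielski graph $M(G)$ of $G$ with $V=\{v_1,\dots,v_n\}$ is obtained from $G$ by adding, for each $i$, a new vertex $u_i$ adjacent to every vertex of $N_G(v_i)$, and then adding one further vertex $u$ adjacent to all of $u_1,\dots,u_n$ (and to nothing else). *)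

(* Defs.v *)
From mathcomp Require Import all_boot.

Set Implicit Arguments.
Unset Strict Implicit.
Unset Printing Implicit Defensive.

Record sgraph := SGraph {
  vertex :> finType;
  adj : rel vertex;
  adj_sym : symmetric adj;
  adj_irrefl : irreflexive adj }.

Section Graph.
Variable G : sgraph.
Implicit Types (x y : G) (C : {set G}).

Definition nbh x : {set G} := [set y | adj x y].

(* The empty graph is not considered connected. *)
Definition connected_graph : Prop :=
  0 < #|G| /\ forall x y, connect (@adj G) x y.

Definition isolated x : Prop := nbh x = set0.

Definition false_twins x y : Prop := x <> y /\ nbh x = nbh y.

Definition OLD_set C : bool :=
  [forall x, nbh x :&: C != set0] &&
  [forall x, forall y, (x != y) ==> (nbh x :&: C != nbh y :&: C)].

Lemma OLD_setP C :
  reflect ((forall x, nbh x :&: C <> set0) /\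
           (forall x y, x <> y -> nbh x :&: C <> nbh y :&: C))
          (OLD_set C).
Proof.
apply: (iffP andP) => -[H1 H2]; split.
- by move=> x; apply/eqP; apply: (forallP H1).
- move=> x y /eqP xy; apply/eqP.
  by move/forallP/(_ x)/forallP/(_ y)/implyP: H2; apply.
- by apply/forallP => x; apply/eqP.
- apply/forallP => x; apply/forallP => y; apply/implyP => /eqP xy.
  by apply/eqP; apply: H2.
Qed.

(* If G has no OLD-set this is #|G|; see gamma_OLDP for the graphs without
   isolated vertices and without false twins, for which OLD-sets exist. *)
Definition gamma_OLD : nat := #|[arg min_(C < setT | OLD_set C) #|C|]|.

Lemma OLD_setT :
  (forall x, ~ isolated x) -> (forall x y, ~ false_twins x y) -> OLD_set setT.
Proof.
move=> noiso notw; apply/OLD_setP; split=> [x|x y xy]; rewrite !setIT.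
  exact: noiso.
by move=> Nxy; apply: (notw x y).
Qed.

Lemma gamma_OLDP :
  (forall x, ~ isolated x) -> (forall x y, ~ false_twins x y) ->
  (exists2 C, OLD_set C & #|C| = gamma_OLD) /\
  (forall C, OLD_set C -> gamma_OLD <= #|C|).
Proof.
move=> noiso notw; rewrite /gamma_OLD.
case: arg_minnP => [|C oldC minC]; first exact: OLD_setT.
by split=> //; exists C.
Qed.

End Graph.

Section Mycielski.
Variable G : sgraph.

(* Some (inl v_i) is the original vertex v_i, Some (inr v_i) is its copy u_i,
   and None is the apex u. *)
Definition mycielski_adj (a b : option (G + G)%type) : bool :=
  match a, b with
  | Some (inl x), Some (inl y) => adj x y
  | Some (inl x), Some (inr y) => adj y x
  | Some (inr x), Some (inl y) => adj x y
  | Some (inr _), None => true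
  | None, Some (inr _) => true
  | _, _ => false
  end.

Lemma mycielski_sym : symmetric mycielski_adj.
Proof. by case=> [[x|x]|] [[y|y]|] //=; apply: adj_sym. Qed.

Lemma mycielski_irrefl : irreflexive mycielski_adj.
Proof. by case=> [[x|x]|] //=; apply: adj_irrefl. Qed.

Definition mycielski : sgraph := SGraph mycielski_sym mycielski_irrefl.

Lemma neighbourP (H : sgraph) (x : H) : ~ isolated x -> exists y, adj x y.
Proof.
by move/eqP/set0Pn => [y]; rewrite inE; exists y.
Qed.

Lemma mycielski_no_isolated :
  connected_graph G -> (forall x : G, ~ isolated x) ->
  forall a : mycielski, ~ isolated a.
Proof.
move=> [/card_gt0P [x0 _] _] noiso a /setP iso; case: a iso => [[x|x]|] iso.
- have [y xy] := neighbourP (noiso x).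
  by have := iso (Some (inl y)); rewrite !inE /= xy.
- by have := iso None; rewrite !inE.
- by have := iso (Some (inr x0)); rewrite !inE.
Qed.

Lemma mycielski_no_false_twins :
  (forall x : G, ~ isolated x) -> (forall x y : G, ~ false_twins x y) ->
  forall a b : mycielski, ~ false_twins a b.
Proof.
move=> noiso notw a b [ab /setP N].
have Nl z : mycielski_adj a (Some (inl z)) = mycielski_adj b (Some (inl z)).
  by have := N (Some (inl z)); rewrite !inE.
have N0 : mycielski_adj a None = mycielski_adj b None.
  by have := N None; rewrite !inE.
case: a b ab {N} Nl N0 => [[x|x]|] [[y|y]|] //= ab Nl N0.
- apply: (notw x y); split; first by move=> E; apply: ab; rewrite E.
  by apply/setP => z; rewrite !inE.
- by have [z xz] := neighbourP (noiso x); rewrite Nl in xz.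
- apply: (notw x y); split; first by move=> E; apply: ab; rewrite E.
  by apply/setP => z; rewrite !inE.
- by have [z yz] := neighbourP (noiso y); rewrite -Nl in yz.
Qed.

Lemma mycielski_connected :
  connected_graph G -> (forall x : G, ~ isolated x) ->
  connected_graph mycielski.
Proof.
move=> [/card_gt0P [x0 _] conn] noiso.
split; first by apply/card_gt0P; exists None.
have sym : connect_sym (@adj mycielski).
  by apply: sym_connect_sym; apply: mycielski_sym.
suff toN a : connect (@adj mycielski) a None.
  by move=> a b; apply: connect_trans (toN a) _; rewrite sym.
case: a => [[x|x]|]; last exact: connect0.
- have [y xy] := neighbourP (noiso x).
  apply: (@connect_trans _ _ (Some (inr y) : mycielski)); apply: connect1 => //=.
  by rewrite adj_sym.
- exact: connect1.
Qed.

End Mycielski.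

(* Main.v *)
Require Import Defs.
From mathcomp Require Import all_boot.

(** An OLD-set [C] of [G], together with the apex [u] and one arbitrary copy
    [u_j], is an OLD-set of [M(G)]. The traces on [C] of the neighbourhoods of
    [v_i] and [u_i] both equal the trace of [N(v_i)], so they separate different
    indices; the apex separates [v_i] from [u_i]; and the neighbourhood of the
    apex has the trace [{u_j}], the only one that avoids [C]. *)

Definition mycielski_code {G : sgraph} (C : {set G}) (j : G) :
    {set mycielski G} :=
  None |: (Some (inr j) |: [set Some (inl x) | x in C]).

Lemma card_mycielski_code {G : sgraph} (C : {set G}) (j : G) :
  #|mycielski_code C j| <= #|C| + 2.
Proof.
rewrite /mycielski_code !cardsU1 addnA addnC.
by rewrite leq_add ?leq_imset_card // (leq_add (leq_b1 _) (leq_b1 _)).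
Qed.

Lemma mem_mycielski_code {G : sgraph} (C : {set G}) (j x : G) :
  (Some (inl x) \in mycielski_code C j) = (x \in C).
Proof.
rewrite !inE /=; apply/imsetP/idP => [[y yC [->]] //|xC].
by exists x.
Qed.

Lemma OLD_set_mycielski_code {G : sgraph} {C : {set G}} (j : G) :
  OLD_set C -> OLD_set (mycielski_code C j).
Proof.
move=> /OLD_setP[domC sepC].
have codeN : None \in mycielski_code C j by rewrite !inE.
have codej : Some (inr j) \in mycielski_code C j by rewrite !inE eqxx orbT.
have dom x : exists2 z, adj x z & z \in C.
  by have /eqP/set0Pn[z] := domC x; rewrite !inE => /andP[]; exists z.
apply/OLD_setP; split=> [a|a b ab] /setP N.
  have Nl z := N (Some (inl z)).
  (* Dominating vertices: a neighbour in [C] for [v_x], the apex for [u_x], and [u_j] for the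
     apex. *)
  case: a N Nl => [[x|x]|] N Nl.
  - have [z xz zC] := dom x.
    by have := Nl z; rewrite inE mem_mycielski_code zC !inE /= xz.
  - by have := N None; rewrite inE codeN !inE.
  - by have := N (Some (inr j)); rewrite inE codej !inE.
have {}Nl z : z \in C ->
    mycielski_adj a (Some (inl z)) = mycielski_adj b (Some (inl z)).
  move=> zC; have := N (Some (inl z)).
  by rewrite !in_setI mem_mycielski_code zC !andbT !inE.
have {}N : mycielski_adj a None = mycielski_adj b None.
  by have := N None; rewrite !in_setI codeN !andbT !inE.
have sep x y : x <> y -> ~ {in C, forall z, adj x z = adj y z}.
  move=> xy eq_xy; apply: (sepC x y) => //; apply/setP=> z; rewrite !inE.
  by case zC: (z \in C); rewrite ?andbF // eq_xy.
(* Only copies are adjacent to the apex, so [N] closes every pair with exactly one copy. This leaves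
   two originals, two copies, or an original against the apex, which has no original neighbour. *)
case: a b ab N Nl => [[x|x]|] [[y|y]|] //= ab _ Nl.
- by apply: (sep x y) => // xy; apply: ab; rewrite xy.
- by have [z xz zC] := dom x; rewrite Nl in xz.
- by apply: (sep x y) => // xy; apply: ab; rewrite xy.
- by have [z yz zC] := dom y; rewrite -Nl in yz.
Qed.

Theorem theorem5 (G : sgraph) (Gconn : connected_graph G)
    (Gnoiso : forall x : G, ~ isolated x)
    (Gnotwins : forall x y : G, ~ false_twins x y) :
  gamma_OLD (mycielski G) <= gamma_OLD G + 2.
Proof.
(* OLD-sets exist in both graphs, so each [gamma_OLD] is a true minimum, not a default value. *)
have [[C oldC <-] _] := gamma_OLDP Gnoiso Gnotwins.
have [_ minM] := gamma_OLDP (mycielski_no_isolated Gconn Gnoiso)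
                            (mycielski_no_false_twins Gnoiso Gnotwins).
(* Connectedness includes nonemptiness, which supplies the index of the copy. *)
have [/card_gt0P[j _] _] := Gconn.
apply: leq_trans (minM _ (OLD_set_mycielski_code j oldC)) _.
exact: card_mycielski_code.
Qed.
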